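(* Let $\Delta(\mathfrak{e}_6)=\{\alpha_1,\dots,\alpha_6\}$ be the simple system of $\mathfrak{e}_6$ and let $sp(8,\mathbb{C})\subset\mathfrak{e}_6$ be the symmetric subalgebra, both as described in the context. The standard $sp(8,\mathbb{C})$-compatible parabolic subalgebras of $\mathfrak{e}_6$ are exactly those $\mathfrak{p}_\Pi$, $\Pi\subseteq\Delta(\mathfrak{e}_6)$, such that (1) either $\{\alpha_2,\alpha_6\}\subseteq\Pi$ or $\{\alpha_2,\alpha_6\}\cap\Pi=\emptyset$; and (2) either $\{\alpha_3,\alpha_5\}\subseteq\Pi$ or $\{\alpha_3,\alpha_5\}\cap\Pi=\emptyset$.
   Context: Let $\mathfrak{h}$ be a Cartan subalgebra of $\mathfrak{g}=\mathfrak{e}_6$ with simple roots $\alpha_1,\dots,\alpha_6$ having Cartan matrix $$\begin{pmatrix}2&0&0&-1&0&0\\0&2&-1&0&0&0\\0&-1&2&-1&0&0\\-1&0&-1&2&-1&0\\0&0&0&-1&2&-1\\0&0&0&0&-1&2\end{pmatrix},$$ positive system $\Phi^+$, and let $H_\alpha$ denote the co-root of $\alpha$. The subalgebra $sp(8,\mathbb{C})=\mathfrak{g}^\tau$ is the fixed-point algebra of an involutive automorphism $\tau$ of $\mathfrak{e}_6$, embedded so that it has a Cartan subalgebra $\mathfrak{h}_{sp(8,\mathbb{C})}\subset\mathfrak{h}$ with simple system given by (the restrictions of) $\beta_1=\alpha_1+\frac12\alpha_3+\alpha_4+\frac12\alpha_5$, $\beta_2=\frac12\alpha_2+\frac12\alpha_6$,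 $\beta_3=\frac12\alpha_3+\frac12\alpha_5$, $\beta_4=\alpha_4$ ($\beta_4$ long), and $\mathfrak{h}_{sp(8,\mathbb{C})}$ is spanned over $\mathbb{C}$ by the co-roots $H_{\beta_1}=2H_{\alpha_1}+H_{\alpha_3}+2H_{\alpha_4}+H_{\alpha_5}$, $H_{\beta_2}=H_{\alpha_2}+H_{\alpha_6}$, $H_{\beta_3}=H_{\alpha_3}+H_{\alpha_5}$, $H_{\beta_4}=H_{\alpha_4}$. For $\Pi\subseteq\Delta(\mathfrak{e}_6)$, the standard parabolic subalgebra is $\mathfrak{p}_\Pi=\mathfrak{h}+\sum_{\alpha\in\Phi^+}\mathfrak{g}_\alpha+\sum_{\alpha\in\mathbb{N}\Pi\cap\Phi^+}\mathfrak{g}_{-\alpha}$, where $\mathfrak{g}_\alpha$ is the root space of $\alpha$ and $\mathbb{N}\Pi$ denotes the non-negative integer combinations of elements of $\Pi$. A semisimple element $H\in\mathfrak{g}$ is hyperbolic if all eigenvalues of $\mathrm{ad}(H)$ on $\mathfrak{g}$ are real; for such $H$, $\mathfrak{p}(H)$ is the sum of the eigenspaces of $\mathrm{ad}(H)$ with eigenvalues $\ge 0$, a parabolic subalgebra of $\mathfrak{g}$. For a reductive subalgebra $\mathfrak{g}'$ of $\mathfrak{g}$, a parabolic subalgebra $\mathfrak{p}$ of $\mathfrak{g}$ is $\mathfrak{g}'$-compatible if there exists $H\in\mathfrak{g}'$, hyperbolic as an element of $\mathfrak{g}$, with $\mathfrak{p}=\mathfrak{p}(H)$. *)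

(* Defs.v *)
From HB Require Import structures.
From mathcomp Require Import all_boot all_order all_algebra.
From mathcomp Require Import complex.
From mathcomp Require Import classical_sets reals.

Set Implicit Arguments.
Unset Strict Implicit.
Unset Printing Implicit Defensive.

Import GRing.Theory Num.Theory.
Local Open Scope classical_set_scope.
Local Open Scope ring_scope.
Local Open Scope complex_scope.

HB.mixin Record Vector_hasLieBracket (F : fieldType) L of Vector F L := {
  lie : L -> L -> L;
  lie_linear_l : forall z, linear (lie^~ z);
  lie_linear_r : forall x, linear (lie x);
  liexx : forall x, lie x x = 0;
  lie_jacobi : forall x y z,
    lie x (lie y z) + lie y (lie z x) + lie z (lie x y) = 0
}.

(* Finite-dimensional Lie algebras over a field. *)
#[short(type="lieAlgType")]
HB.structure Definition LieAlgebra (F : fieldType) :=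
  { L of Vector F L & Vector_hasLieBracket F L }.

Section LinearSpan.
Variables (F : fieldType) (V : vectType F).

(* The sum of a family of subspaces is encoded below as the linear span of the
   union of the family, since the index sets (roots, eigenvalues) are not
   finite types. *)
Definition lin_span (A : set V) : set V :=
  [set x | exists2 s : seq V, (forall y, y \in s -> A y) & x \in <<s>>%VS].

End LinearSpan.

Section LieTheory.
Variables (F : fieldType) (g : lieAlgType F).
Implicit Types (L h U : {vspace g}) (x H : g).

Definition ad x : 'End(g) := linfun (lie x).

Definition is_ideal U := forall x y, y \in U -> lie x y \in U.

Definition is_simple_lie :=
  (exists x y : g, lie x y != 0) /\
  (forall U, is_ideal U -> U = 0%VS \/ U = fullv).

Definition is_abelian U := forall x y, x \in U -> y \in U -> lie x y = 0.

(* The notions below are relative to a Lie subalgebra L of g; the case of g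
   itself is L = fullv. *)

(* ad(x) acts diagonalizably on L; over an algebraically closed field this is
   the semisimplicity of ad(x). *)
Definition ad_semisimple L x :=
  forall y, y \in L ->
    lin_span (\bigcup_(a : F) [set z | z \in (L :&: passmx.leigenspace (ad x) a)%VS]) y.

(* Cartan subalgebra of a semisimple Lie algebra L: a maximal abelian
   subalgebra all of whose elements are ad-semisimple. *)
Definition is_cartan L h :=
  [/\ (h <= L)%VS, is_abelian h,
      (forall U, (h <= U)%VS -> (U <= L)%VS -> is_abelian U -> U = h)
    & (forall x, x \in h -> ad_semisimple L x)].

Definition dual h := 'Hom(subvs_of h, F^o).

(* The value a(x); meaningful for x in h. *)
Definition ev h (a : dual h) x : F := a (vsproj h x).

(* Restriction of linear forms from h to a subspace h' of h. *)
Definition restr_dual h h' (a : dual h) : dual h' :=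
  linfun (fun y : subvs_of h' => ev a (vsval y) : F^o).

Definition root_space L h (a : dual h) : set g :=
  [set x | x \in L /\ forall y, y \in h -> lie y x = ev a y *: x].

Definition is_root L h (a : dual h) :=
  a != 0 /\ exists2 x, root_space L a x & x != 0.

Definition nat_comb n h (S : {set 'I_n}) (delta : 'I_n -> dual h) (a : dual h) :=
  exists c : 'I_n -> nat, a = \sum_(i in S) delta i *+ c i.

Definition is_simple_system n L h (delta : 'I_n -> dual h) :=
  [/\ free [seq delta i | i <- enum 'I_n],
      (forall i, is_root L (delta i))
    & (forall a, is_root L a ->
         nat_comb [set: 'I_n]%SET delta a \/ nat_comb [set: 'I_n]%SET delta (- a))].

Definition is_positive_root n L h (delta : 'I_n -> dual h) (a : dual h) :=
  is_root L a /\ nat_comb [set: 'I_n]%SET delta a.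

(* The co-root of a is the element H of [L_a, L_{-a}] with a(H) = 2. *)
Definition is_coroot L h (a : dual h) H :=
  [/\ H \in h, ev a H = 2
    & lin_span [set z | exists x y,
        [/\ root_space L a x, root_space L (- a) y & z = lie x y]] H].

(* Subsets Pi of the simple system are given by subsets of its index set. *)
Definition std_parabolic n h (delta : 'I_n -> dual h) (Pi : {set 'I_n}) : set g :=
  lin_span ([set x | x \in h]
    `|` \bigcup_(a in [set a | is_positive_root fullv delta a])
          root_space fullv a
    `|` \bigcup_(a in [set a | is_positive_root fullv delta a /\ nat_comb Pi delta a])
          root_space fullv (- a)).

Definition is_involutive_automorphism (tau : 'End(g)) :=
  [/\ forall x y, tau (lie x y) = lie (tau x) (tau y),
      (tau \o tau = \1)%VF & tau != \1%VF].

End LieTheory.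

Section Complex.
Variables (R : realType) (g : lieAlgType R[i]).

Definition is_hyperbolic (H : g) :=
  ad_semisimple fullv H /\
  (forall a, passmx.leigenvalue (ad H) a -> a \is Num.real).

(* In R[i], 0 <= a means that a is real and nonnegative. *)
Definition parabolic_of (H : g) : set g :=
  lin_span (\bigcup_(a in [set a : R[i] | 0 <= a])
              [set x | x \in passmx.leigenspace (ad H) a]).

Definition is_compatible (L : {vspace g}) (p : set g) :=
  exists H : g, [/\ H \in L, is_hyperbolic H & p = parabolic_of H].

Definition symplectic_form : 'M[R[i]]_(4 + 4) :=
  block_mx 0 1%:M (- 1%:M) 0.

(* The subalgebra L is isomorphic to the matrix Lie algebra sp(8,C). *)
Definition is_isomorphic_to_sp8 (L : {vspace g}) :=
  exists f : 'Hom(g, 'M[R[i]]_(4 + 4)),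
    [/\ {in L &, injective f},
        forall X, X \in (f @: L)%VS <->
          X^T *m symplectic_form + symplectic_form *m X = 0
      & {in L &, forall x y, f (lie x y) = f x *m f y - f y *m f x}].

End Complex.

(* One-based labels: the simple root alpha_k is alpha (lab k). *)
Definition lab (k : nat) : 'I_6 := inord k.-1.

Definition cartan_e6 : 'M[int]_6 :=
  \matrix_(i, j) nth 0 (nth [::]
    [:: [::  2;  0;  0; -1;  0;  0];
        [::  0;  2; -1;  0;  0;  0];
        [::  0; -1;  2; -1;  0;  0];
        [:: -1;  0; -1;  2; -1;  0];
        [::  0;  0;  0; -1;  2; -1];
        [::  0;  0;  0;  0; -1;  2]] i) j.

Section Sp8InE6.
Variables (F : fieldType) (g : lieAlgType F) (h : {vspace g}).
Variables (alpha : 'I_6 -> dual h) (coroot : 'I_6 -> g).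

Definition beta (j : 'I_4) : dual h :=
  nth 0 [:: alpha (lab 1) + 2^-1 *: alpha (lab 3) + alpha (lab 4)
              + 2^-1 *: alpha (lab 5);
            2^-1 *: alpha (lab 2) + 2^-1 *: alpha (lab 6);
            2^-1 *: alpha (lab 3) + 2^-1 *: alpha (lab 5);
            alpha (lab 4)] j.

Definition beta_coroot (j : 'I_4) : g :=
  nth 0 [:: coroot (lab 1) *+ 2 + coroot (lab 3) + coroot (lab 4) *+ 2
              + coroot (lab 5);
            coroot (lab 2) + coroot (lab 6);
            coroot (lab 3) + coroot (lab 5);
            coroot (lab 4)] j.

Definition h_sp8 : {vspace g} := <<[seq beta_coroot j | j <- enum 'I_4]>>%VS.

End Sp8InE6.

(* Main.v *)
From HB Require Import structures.
From mathcomp Require Import boolp classical_sets.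
Require Import Defs.
From mathcomp Require Import all_boot all_order all_algebra.
From mathcomp Require Import complex.
From mathcomp Require Import reals ring.
Import Order.TTheory GRing.Theory Num.Theory.

(** Write theta for the symmetry of the Dynkin diagram that exchanges alpha_2
    with alpha_6 and alpha_3 with alpha_5.  The two conditions on Pi say that
    Pi is stable under theta, and h_sp8 is the set of the H in h on which
    alpha_i and alpha_(theta i) agree for all i.  With labels counted from 0 in
    Z/6, theta i is simply - i.  The key fact is that tau
    normalises h and acts on it through theta: alpha_i o tau = alpha_(theta i)
    ([ev_alpha_tau]).

    To see this, note that h_sp8 contains an element rho on which all simple
    roots are 1 ([coweight], by inverting the Cartan matrix).  No root vanishes
    on rho, so h is the centraliser of rho ([regular_centralizer]), and since
    tau fixes rho it maps h to itself.  Then alpha_i o tau is a root that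
    agrees with alpha_i on h_sp8, which leaves only alpha_i and alpha_(theta i)
    ([root_eq_simple_on_h_sp8]).  If tau fixed alpha_i, then, as y + tau y lies
    in h_sp8 for y in h, the forms alpha_i and alpha_(theta i) would agree on
    all of h, and the two alternatives coincide.

    If p_Pi = p(H) with tau H = H, then p_Pi is stable under tau.  For i in Pi,
    tau carries the root space of - alpha_i, which lies in p_Pi, to the root
    space of - alpha_(theta i), so theta i is in Pi.

    Conversely, if Pi is theta-stable, let H in h be the element on which
    alpha_i takes the value 0 for i in Pi and 1 otherwise.  It lies in h_sp8,
    and p(H) = p_Pi follows from the root space decomposition
    ([parabolic_of_dominant]).  As p_Pi is defined with the negatives of
    positive roots, this needs that the opposite of a root is a root
    ([is_root_opp]); simplicity of g gives it through the trace form
    tr(ad x ad y). *)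

Set Implicit Arguments.
Unset Strict Implicit.
Unset Printing Implicit Defensive.

Local Open Scope ring_scope.
Local Open Scope complex_scope.

(** * Linear spans of eigenvectors *)

Section Spans.
Local Open Scope classical_set_scope.
Variables (F : fieldType) (V : vectType F).
Implicit Types (A B U : set V) (S T : set F) (f : 'End(V)) (x y : V).

Definition lin_closed U := U 0 /\ forall c x y, U x -> U y -> U (c *: x + y).

Lemma lin_closed_sum U (I : eqType) (r : seq I) (v : I -> V) :
  lin_closed U -> (forall i, i \in r -> U (v i)) -> U (\sum_(i <- r) v i).
Proof.
move=> [U0 UD] Uv; rewrite big_seq; elim/big_ind: _ => // x y Ux Uy.
by rewrite -[x]scale1r; apply: UD.
Qed.

Lemma lin_closedZ U c x : lin_closed U -> U x -> U (c *: x).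
Proof. by move=> [U0 UD] Ux; rewrite -[_ *: _]addr0; apply: UD. Qed.

Lemma lin_closedB U x y : lin_closed U -> U x -> U y -> U (x - y).
Proof. by move=> [U0 UD] Ux Uy; rewrite addrC -scaleN1r; apply: UD. Qed.

Lemma lin_closed_vspace (W : {vspace V}) : lin_closed [set x | x \in W].
Proof.
by split=> [|c x y /= Wx Wy]; rewrite /= ?mem0v // rpredD // rpredZ.
Qed.

Lemma lin_span_closed A : lin_closed (lin_span A).
Proof.
split=> [|c x y [s sA sx] [t tA ty]]; first by exists [::]; rewrite ?mem0v.
exists (s ++ t) => [z|]; first by rewrite mem_cat => /orP[/sA|/tA].
by rewrite span_cat memv_add // rpredZ.
Qed.

Lemma lin_span_gen A : A `<=` lin_span A.
Proof.
by move=> x Ax; exists [:: x] => [y|]; rewrite ?inE ?memv_span1 // => /eqP->.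
Qed.

Lemma lin_span_min A U : lin_closed U -> A `<=` U -> lin_span A `<=` U.
Proof.
move=> clU AU x [s sA /(@coord_span _ _ _ (in_tuple s)) ->].
apply: lin_closed_sum => // i _; apply: lin_closedZ => //; apply/AU/sA.
exact: mem_nth.
Qed.

Lemma lin_spanU A B x : lin_span (A `|` B) x ->
  exists y z, [/\ lin_span A y, lin_span B z & x = y + z].
Proof.
have [A0 AD] := lin_span_closed A; have [B0 BD] := lin_span_closed B.
move: x; apply: lin_span_min => [|x [Ax|Bx]]; last 2 first.
- by exists x, 0; rewrite addr0; split=> //; apply: lin_span_gen.
- by exists 0, x; rewrite add0r; split=> //; apply: lin_span_gen.
split=> [|c x1 x2 [y1 [z1 [Ay1 Bz1 ->]]] [y2 [z2 [Ay2 Bz2 ->]]]].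
  by exists 0, 0; rewrite addr0.
exists (c *: y1 + y2), (c *: z1 + z2); rewrite scalerDr addrACA.
by split; [apply: AD | apply: BD |].
Qed.

Definition eigen_union f S : set V := [set x | exists2 a, S a & f x = a *: x].

Lemma mem_leigenspace f a x : (x \in passmx.leigenspace f a) = (f x == a *: x).
Proof.
by rewrite memv_ker add_lfunE opp_lfunE scale_lfunE id_lfunE subr_eq0.
Qed.

(** A spanning sequence of eigenvectors may repeat eigenvalues; collecting
    equal ones gives one summand for each eigenvalue, as the next lemma
    requires. *)
Lemma lin_span_eigen_sum f S x : lin_span (eigen_union f S) x ->
  exists (s : seq F) (v : F -> V),
    [/\ uniq s, forall a, a \in s -> S a, forall a, f (v a) = a *: v a
      & x = \sum_(a <- s) v a].
Proof.
case=> r; elim: r x => [|z r IH] x rS.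
  rewrite span_nil memv0 => /eqP->; exists [::], (fun=> 0); rewrite big_nil.
  by split=> // a; rewrite linear0 scaler0.
rewrite span_cons => /memv_addP[_ /vlineP[c ->]] [y ry ->].
have /IH[|s [v [us sS fv ->]]] := ry.
  by move=> t rt; apply: rS; rewrite inE rt orbT.
have [b Sb fz] : eigen_union f S z by apply: rS; rewrite mem_head.
have fcz a : f (if a == b then c *: z else 0)
    = a *: (if a == b then c *: z else 0).
  case: eqP => [->|_]; last by rewrite linear0 scaler0.
  by rewrite linearZ /= fz !scalerA mulrC.
have fv' a : f (v a + if a == b then c *: z else 0)
   = a *: (v a + if a == b then c *: z else 0).
  by rewrite linearD /= fv fcz scalerDr.
have [bs|bs] := boolP (b \in s).
  exists s, (fun a => v a + if a == b then c *: z else 0); split=> //.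
  rewrite big_split /= [X in _ = _ + X](bigD1_seq b) //= eqxx.
  by rewrite [X in _ + (_ + X)]big1 => [|a /negPf->]; rewrite ?addr0 // addrC.
exists (b :: s), (fun a => if a == b then c *: z else v a); split=> [|a||] /=.
- by rewrite bs.
- by rewrite inE => /orP[/eqP->|/sS].
- by move=> a; case: eqP (fcz a).
- rewrite big_cons eqxx; congr (_ + _); apply: eq_big_seq => a sa.
  by case: eqP sa bs => // -> ->.
Qed.

(** For an eigenvalue b of the sum, applying f - b kills the component at b and
    multiplies each other component at a by a - b, which is nonzero; this is
    an induction on the number of components. *)
Lemma eigen_sum_components f U (s : seq F) (v : F -> V) :
    lin_closed U -> (forall x, U x -> U (f x)) -> uniq s ->
    (forall a, f (v a) = a *: v a) -> U (\sum_(a <- s) v a) ->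
  forall a, a \in s -> U (v a).
Proof.
move=> clU fU; elim: s v => [|b s IH] v //= /andP[bs us] fv.
rewrite big_cons => Uv.
have Us a : a \in s -> U (v a).
  move=> sa; have ab : a - b != 0.
    by rewrite subr_eq0; apply: contraNneq bs => <-.
  rewrite -[v a](scalerK ab); apply: lin_closedZ => //.
  apply: (IH (fun a => (a - b) *: v a)) => // [c|].
    by rewrite linearZ /= fv !scalerA mulrC.
  have -> : \sum_(a <- s) (a - b) *: v a
      = f (v b + \sum_(a <- s) v a) - b *: (v b + \sum_(a <- s) v a).
    rewrite linearD linear_sum /= fv scalerDr opprD addrACA subrr add0r.
    rewrite scaler_sumr -sumrB; apply: eq_bigr => c _.
    by rewrite fv scalerBl.
  by apply: lin_closedB; [|apply: fU|apply: lin_closedZ].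
move=> a; rewrite inE => /orP[/eqP->|/Us//].
rewrite -[v b](addrK (\sum_(a <- s) v a)); apply: lin_closedB => //.
exact: lin_closed_sum.
Qed.

(** A stable subspace of a diagonalisable f is spanned by eigenvectors.  This
    one fact yields both the independence of eigenspaces (next lemma) and
    the simultaneous diagonalisation of commuting maps. *)
Lemma lin_span_eigen_stable f S U x :
    lin_closed U -> (forall y, U y -> U (f y)) -> U x ->
  lin_span (eigen_union f S) x -> lin_span (eigen_union f S `&` U) x.
Proof.
move=> clU fU Ux /lin_span_eigen_sum[s [v [us sS fv xE]]]; rewrite xE in Ux *.
apply: lin_closed_sum => [|a sa]; first exact: lin_span_closed.
apply: lin_span_gen; split; first by exists a => //; apply: sS.
exact: eigen_sum_components fv Ux a sa.
Qed.

Lemma lin_span_eigen_disjoint f S T x : (forall a, S a -> ~ T a) ->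
  lin_span (eigen_union f S) x -> lin_span (eigen_union f T) x -> x = 0.
Proof.
move=> ST xS xT.
have cl0 : lin_closed [set z : V | z = 0].
  by split=> [|c z w /= -> ->] //=; rewrite scaler0 addr0.
(* An eigenvector for b outside S: intersect the span with the b-eigenspace,
   where each eigenvector for some a in S is zero. *)
have one b y : ~ S b -> f y = b *: y -> lin_span (eigen_union f S) y -> y = 0.
  move=> Sb fy yS; pose U := [set z | z \in passmx.leigenspace f b].
  have : lin_span (eigen_union f S `&` U) y.
    apply: lin_span_eigen_stable yS => [|z|]; first exact: lin_closed_vspace.
      by rewrite /U /= !mem_leigenspace => /eqP fz; rewrite !fz linearZ /= fz.
    by rewrite /U /= mem_leigenspace fy.
  move: y {fy yS}; apply: lin_span_min => // z [[a Sa fz]].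
  rewrite /U /= mem_leigenspace fz -subr_eq0 -scalerBl scaler_eq0 subr_eq0.
  by case/orP=> /eqP // ab; rewrite -ab in Sb.
have clS := lin_span_closed (eigen_union f S).
have : lin_span (eigen_union f T `&` lin_span (eigen_union f S)) x.
  apply: lin_span_eigen_stable xT => // y.
  move: y; apply: lin_span_min => [|y yS].
    split=> [|c y z /= yS zS] /=; first by rewrite linear0; case: clS.
    by rewrite linearP; case: clS => _; apply.
  have [a _ fy] := yS; rewrite /= fy; apply: lin_closedZ => //.
  exact: lin_span_gen.
move: x {xS xT}; apply: lin_span_min => // z [[b Tb fz] zS].
by apply: one fz zS => /ST.
Qed.

End Spans.

(** * Root space decomposition *)

Section Roots.
Local Open Scope classical_set_scope.
Variables (F : fieldType) (g : lieAlgType F).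
Implicit Types (h : {vspace g}) (x y z : g).

HB.instance Definition _ x :=
  GRing.isLinear.Build F g g *:%R (lie x) (@lie_linear_r F g x).

Lemma adE x y : ad x y = lie x y.
Proof. exact: lfunE. Qed.

Lemma lieDl x y z : lie (x + y) z = lie x z + lie y z.
Proof. by have /= := lie_linear_l z 1 x y; rewrite !scale1r. Qed.

Lemma lieZl c x z : lie (c *: x) z = c *: lie x z.
Proof.
have l0 : lie 0 z = 0.
  by have /= := lie_linear_l z (-1) 0 0; rewrite scaler0 addr0 scaleN1r addNr.
by have /= := lie_linear_l z c x 0; rewrite l0 !addr0.
Qed.

Lemma lieC x y : lie x y = - lie y x.
Proof.
apply/eqP; rewrite -addr_eq0; apply/eqP.
by have := liexx (x + y); rewrite lieDl !raddfD /= !liexx add0r addr0.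
Qed.

Lemma lie_comm x y z : lie x y = 0 -> lie x (lie y z) = lie y (lie x z).
Proof.
move=> xy; have := lie_jacobi x y z.
by rewrite xy raddf0 addr0 [lie z x]lieC raddfN /= => /subr0_eq.
Qed.

Lemma cartan_eigen_span h H x : is_cartan fullv h -> H \in h ->
  lin_span (eigen_union (ad H) [set: F]) x.
Proof.
case=> _ _ _ ss hH; have := ss H hH x (memvf x).
move: x; apply: lin_span_min => [|z [a _]]; first exact: lin_span_closed.
rewrite /= capfv mem_leigenspace => /eqP fz.
by apply: lin_span_gen; exists a.
Qed.

(** Commuting diagonalisable maps are simultaneously diagonalisable: each
    common eigenspace of the ad w, for w in ys, is stable under ad y. *)
Lemma simultaneous_eigen_span h (ys : seq g) x : is_cartan fullv h ->
    {subset ys <= h} ->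
  lin_span [set z | forall y, y \in ys -> exists a, lie y z = a *: z] x.
Proof.
move=> hC; elim: ys => [|y ys IH] ysh; first exact: lin_span_gen.
have hab : is_abelian h by case: hC.
have hy : y \in h by rewrite ysh ?mem_head.
have {IH} : lin_span
    [set z | forall y, y \in ys -> exists a, lie y z = a *: z] x.
  by apply: IH => w ysw; apply: ysh; rewrite inE ysw orbT.
move: x; apply: lin_span_min => [|z zE]; first exact: lin_span_closed.
(* The common eigenspace of ys that contains z. *)
pose U := [set t | forall w a, w \in ys ->
  lie w z = a *: z -> lie w t = a *: t].
have : lin_span (eigen_union (ad y) [set: F] `&` U) z.
  apply: lin_span_eigen_stable => //; last exact: cartan_eigen_span hC hy.
    split=> [w a _ _|c t u Ut Uu w a wys wz]; first by rewrite linear0 scaler0.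
    rewrite linearP /= (Ut w a) // (Uu w a) // scalerDr !scalerA.
    by rewrite [c * a]mulrC.
  move=> t Ut w a wys wz; rewrite adE lie_comm; last first.
    by apply: hab => //; apply: ysh; rewrite inE wys orbT.
  by rewrite (Ut w a) // linearZ.
move: lin_span_min; apply => [|t [[a _ yt] Ut]]; first exact: lin_span_closed.
apply: lin_span_gen => w; rewrite inE => /orP[/eqP->|wys].
  by exists a; rewrite -adE.
by have [b wz] := zE w wys; exists b; apply: Ut.
Qed.

Lemma dualP h (phi : g -> F) :
    (forall c x y, phi (c *: x + y) = c * phi x + phi y) ->
  exists a : dual h, forall y, y \in h -> ev a y = phi y.
Proof.
move=> phiP; pose f (u : subvs_of h) : F^o := phi (vsval u).
have f_lin : linear f by move=> c u v; rewrite /f linearP phiP.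
pose fL : {linear subvs_of h -> F^o} :=
  HB.pack f (GRing.isLinear.Build _ _ _ _ f f_lin).
by exists (linfun fL) => y hy; rewrite /ev (lfunE fL) /= /f vsprojK.
Qed.

Lemma evD h (a b : dual h) x : ev (a + b) x = ev a x + ev b x.
Proof. by rewrite /ev add_lfunE. Qed.

Lemma evN h (a : dual h) x : ev (- a) x = - ev a x.
Proof. by rewrite /ev opp_lfunE. Qed.

Lemma ev0 h x : ev (0 : dual h) x = 0.
Proof. by rewrite /ev zero_lfunE. Qed.

Lemma ev_sum h (I : finType) (P : pred I) (a : I -> dual h) (c : I -> nat) x :
  ev (\sum_(i | P i) a i *+ c i) x = \sum_(i | P i) (c i)%:R * ev (a i) x.
Proof.
rewrite /ev sum_lfunE; apply: eq_bigr => i _.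
rewrite mulr_natl; elim: (c i) => [|n IH]; first by rewrite zero_lfunE.
by rewrite !mulrS add_lfunE IH.
Qed.

Lemma ev_linear h (a : dual h) c x y :
  ev a (c *: x + y) = c * ev a x + ev a y.
Proof. by rewrite /ev !linearP. Qed.

Lemma ev_inj h (a b : dual h) : (forall y, y \in h -> ev a y = ev b y) -> a = b.
Proof.
move=> ab; apply/lfunP => u; rewrite -[u]vsvalK.
exact/ab/subvsP.
Qed.

(** If x centralises h then h + <[x]> is abelian, since [x, x] = 0, and so
    equals h by maximality. *)
Lemma cartan_centralizer h x : is_cartan fullv h ->
  (forall y, y \in h -> lie y x = 0) -> x \in h.
Proof.
move=> [_ hab hmax _] hx; rewrite -(hmax (h + <[x]>)%VS).
- by rewrite memvE addvSr.
- exact: addvSl.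
- exact: subvf.
- move=> u v /memv_addP[y hy [_ /vlineP[c ->] ->]].
  move=> /memv_addP[z hz [_ /vlineP[d ->] ->]].
  rewrite lieDl !raddfD /= !lieZl hab // !linearZ /= hx // liexx.
  by rewrite [lie x z]lieC hx // oppr0 !scaler0 !addr0.
Qed.

Definition root_vectors h : set g :=
  [set x | exists2 a : dual h, is_root fullv a & root_space fullv a x].

(** A common eigenvector z of a basis of h is an eigenvector of ad y for all
    y in h, and its eigenvalue is linear in y.  If this weight is 0 then z is
    in h, otherwise it is a root. *)
Lemma root_decomposition h x : is_cartan fullv h ->
  lin_span ([set x | x \in h] `|` root_vectors h) x.
Proof.
move=> hC.
have := simultaneous_eigen_span (ys := vbasis h) x hC
  (fun y => @vbasis_mem _ _ y h).
move: x; apply: lin_span_min => [|z zE]; first exact: lin_span_closed.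
apply: lin_span_gen.
have [->|z0] := eqVneq z 0; first by left; apply: mem0v.
have hz y : y \in h -> lie y z \in <[z]>%VS.
  move=> /coord_vbasis ->; rewrite lieC rpredN linear_sum rpred_sum // => i _.
  have [|a za] := zE (vbasis h)`_i; first by rewrite mem_nth ?size_tuple.
  by rewrite linearZ /= lieC za !(rpredZ, rpredN) ?memv_line.
(* The eigenvalue of ad y at z, as the coordinate of [y, z] along z. *)
have [|a az] := @dualP h (fun y => coord [tuple z] ord0 (lie y z)).
  by move=> c x y; rewrite lie_linear_l linearP.
have zr : root_space fullv a z.
  split=> [|y hy]; first exact: memvf.
  rewrite az // {1}(@coord_span _ _ _ [tuple z] (lie y z)) ?big_ord1 //.
  by rewrite span_seq1 hz.
have [a0|a0] := eqVneq a 0; last by right; exists a => //; split=> //; exists z.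
left; apply: cartan_centralizer hC _ => y hy.
by have [_ ->] := zr; rewrite // a0 ev0 scale0r.
Qed.

End Roots.

(** * The trace form, and opposites of roots *)

Section TraceForm.
Local Open Scope classical_set_scope.
Variables (F : fieldType) (g : lieAlgType F) (e : (\dim {:g}).-tuple g).
Hypothesis e_basis : basis_of fullv e.
Implicit Types (h : {vspace g}) (x y z : g).

(** The matrix acts on row vectors of coordinates, hence the reversed order of
    the factors in [ad_mx_lie]. *)
Definition ad_mx x : 'M[F]_(\dim {:g}) :=
  \matrix_(i, j) coord e j (lie x e`_i).

Definition trace_form x y := \tr (ad_mx x *m ad_mx y).

Lemma ad_mx_linear c x y : ad_mx (c *: x + y) = c *: ad_mx x + ad_mx y.
Proof. by apply/matrixP => i j; rewrite !mxE lieDl lieZl linearP. Qed.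

Lemma ad_mx_lie x y :
  ad_mx (lie x y) = ad_mx y *m ad_mx x - ad_mx x *m ad_mx y.
Proof.
have ad_mxM u v i j : (ad_mx u *m ad_mx v) i j = coord e j (lie v (lie u e`_i)).
  rewrite mxE {1}(coord_basis e_basis (memvf (lie u e`_i))) !linear_sum /=.
  by apply: eq_bigr => k _; rewrite !mxE !linearZ.
apply/matrixP => i j; rewrite [RHS]mxE [X in _ + X]mxE !ad_mxM mxE -linearB /=.
congr (coord e j _); have := lie_jacobi x y e`_i.
rewrite [lie e`_i (lie x y)]lieC [lie e`_i x]lieC raddfN /= => /subr0_eq/esym.
by [].
Qed.

Lemma trace_formC x y : trace_form x y = trace_form y x.
Proof. exact: mxtrace_mulC. Qed.

Lemma trace_form_linear x c y z :
  trace_form x (c *: y + z) = c * trace_form x y + trace_form x z.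
Proof. by rewrite /trace_form ad_mx_linear mulmxDr -scalemxAr linearP. Qed.

Lemma trace_form0 x : trace_form x 0 = 0.
Proof.
by have := trace_form_linear x (-1) 0 0; rewrite scaler0 addr0 mulN1r addNr.
Qed.

Lemma trace_form_invariant x y z :
  trace_form (lie x y) z = trace_form x (lie y z).
Proof.
rewrite /trace_form !ad_mx_lie mulmxBl mulmxBr !linearB /= !mulmxA.
by congr (_ - _); rewrite [RHS]mxtrace_mulC mulmxA.
Qed.

(** The radical of the form is an ideal by invariance; as a subspace it is the
    kernel of the map sending x to its products with the basis e. *)
Lemma trace_form_radical_ideal : exists2 U : {vspace g}, is_ideal U &
  forall x, (x \in U) <-> (forall y, trace_form x y = 0).
Proof.
pose r x : 'rV_(\dim {:g}) := \row_j trace_form e`_j x.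
have r_lin : linear r.
  by move=> c x y; apply/rowP => j; rewrite !mxE trace_form_linear.
pose rL : {linear g -> 'rV_(\dim {:g})} :=
  HB.pack r (GRing.isLinear.Build _ _ _ _ r r_lin).
have rP x : x \in lker (linfun rL) <-> (forall y, trace_form x y = 0).
  rewrite memv_ker (lfunE rL) /=; split=> [/eqP/rowP rx y|xK].
    rewrite (coord_basis e_basis (memvf y)).
    elim/big_rec: _ => [|i z _ IH]; first exact: trace_form0.
    have := rx i; rewrite !mxE trace_formC => K0.
    by rewrite trace_form_linear IH K0 mulr0 addr0.
  by apply/eqP/rowP => j; rewrite !mxE trace_formC.
exists (lker (linfun rL)) => // x y /rP yK; apply/rP => z.
by rewrite trace_formC -trace_form_invariant trace_formC.
Qed.

(** For H in h, invariance gives (a + b)(H) * K(x, z) = 0.  The form b may be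
    0, in which case z ranges over h. *)
Lemma trace_form_root_orthogonal h (a b : dual h) x z :
    a + b != 0 -> root_space fullv a x -> root_space fullv b z ->
  trace_form x z = 0.
Proof.
move=> ab [_ hx] [_ hz].
have [H hH abH] : exists2 H, H \in h & ev (a + b) H != 0.
  apply: contrapT => ab0; case/eqP: ab; apply: ev_inj => y hy; rewrite ev0.
  by apply: contrapT => /eqP aby; apply: ab0; exists y.
have := trace_form_invariant x H z.
rewrite lieC hx // hz // -scaleN1r scalerA.
have KZ y c w : trace_form y (c *: w) = c * trace_form y w.
  by have := trace_form_linear y c w 0; rewrite !addr0 trace_form0 addr0.
rewrite trace_formC !KZ [trace_form z x]trace_formC mulN1r => /eqP.
rewrite eq_sym -subr_eq0 -mulrBl opprK mulf_eq0 -evD addrC (negPf abH).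
by move/eqP.
Qed.

End TraceForm.

Section RootOpposite.
Local Open Scope classical_set_scope.

Lemma lin_span_basis (F : fieldType) (V : vectType F) (A : set V) :
    (forall x, lin_span A x) ->
  exists2 e : (\dim {:V}).-tuple V,
    basis_of fullv e & forall i : 'I_(\dim {:V}), A e`_i.
Proof.
move=> AV.
have /(_ (vbasis fullv)) [s sA ts] : forall t : seq V,
    exists2 s : seq V, (forall y, y \in s -> A y) & {subset t <= <<s>>%VS}.
  elim=> [|x t [s sA ts]]; first by exists [::].
  have [r rA rx] := AV x; exists (r ++ s) => y.
    by rewrite mem_cat => /orP[/rA|/sA].
  rewrite span_cat inE => /orP[/eqP->|/ts].
    exact: subvP (addvSl _ _) _ rx.
  exact: subvP (addvSr _ _) _.
have {ts} sV : <<s>>%VS = fullv.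
  apply/eqP; rewrite eqEsubv subvf /= -{1}(span_basis (vbasisP fullv)).
  exact/span_subvP.
have [e [eA ef es]] : exists e : seq V,
    [/\ forall y, y \in e -> A y, free e & <<e>>%VS = fullv].
  rewrite -sV; elim: s sA {sV} => [|x s IH] sA.
    by exists [::]; rewrite nil_free.
  have [y sy|e [eA ef es]] := IH; first by apply: sA; rewrite inE sy orbT.
  have [xs|xs] := boolP (x \in <<s>>%VS).
    exists e; split=> //; rewrite es span_cons; symmetry; exact/addv_idPr.
  exists (x :: e); rewrite free_cons es xs ef !span_cons es; split=> // y.
  by rewrite inE => /orP[/eqP->|/eA //]; apply: sA; rewrite mem_head.
have eb : basis_of fullv e by rewrite /basis_of es eqxx.
have sz : size e == \dim {:V} by move: ef; rewrite /free es eq_sym.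
by exists (Tuple sz) => // i; apply/eA/mem_nth; rewrite (eqP sz).
Qed.

(** If - a is not a root, the root space of a is orthogonal to every weight
    space, hence to g.  So the radical of the trace form is a nonzero ideal,
    and it is g by simplicity.  But in a basis of eigenvectors of ad C,
    tr((ad C)^2) is the sum of the squares of the eigenvalues of ad C; these
    are real, and a(C) is a nonzero one of them, so the sum is not 0. *)
Lemma is_root_opp (F : numFieldType) (g : lieAlgType F) (h : {vspace g})
    (a : dual h) (C : g) : is_simple_lie g -> is_cartan fullv h -> C \in h ->
    (forall b : dual h, is_root fullv b -> ev b C \is Num.real) ->
    ev a C != 0 -> is_root fullv a -> is_root fullv (- a).
Proof.
move=> [_ simple] hC Ch Creal aC [a0 [x ax x0]].
have [e e_basis eC] : exists2 e : (\dim {:g}).-tuple g, basis_of fullv e &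
    forall i : 'I_(\dim {:g}),
      exists2 c, c \is Num.real & lie C e`_i = c *: e`_i.
  apply: (@lin_span_basis _ _
    [set z | exists2 c, c \is Num.real & lie C z = c *: z]).
  move=> y; have := root_decomposition y hC; move: y.
  apply: lin_span_min => [|y [hy|[b br [_ by_]]]]; first exact: lin_span_closed.
    apply: lin_span_gen; exists 0; rewrite ?real0 // scale0r.
    by case: hC => _ hab _ _; apply: hab.
  by apply: lin_span_gen; exists (ev b C); rewrite ?by_ ?Creal.
have [U Uideal UP] := trace_form_radical_ideal e_basis.
apply: contrapT => na; have xU : x \in U.
  apply/UP => y; have := root_decomposition y hC; move: y.
  have cl : lin_closed [set y | trace_form e x y = 0].
    split=> [|c y z /= xy xz]; first exact: trace_form0.
    by rewrite trace_form_linear xy xz mulr0 addr0.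
  apply: lin_span_min => // y [hy|[b [b0 bE] yb]].
    apply: (trace_form_root_orthogonal e_basis (b := 0 : dual h) _ ax).
      by rewrite addr0.
    split=> [|z hz]; first exact: memvf.
    by rewrite ev0 scale0r; case: hC => _ hab _ _; apply: hab.
  have [y0|y0] := eqVneq y 0; first by rewrite y0; case: cl.
  apply: (trace_form_root_orthogonal e_basis (a := a) (b := b)) yb => //.
  apply/eqP => ab; apply: na; move/eqP: ab; rewrite addrC addr_eq0 => /eqP <-.
  by split.
have [U0|Ufull] := simple U Uideal.
  by move: xU; rewrite U0 memv0 (negPf x0).
have /UP/(_ C) : C \in U by rewrite Ufull memvf.
rewrite /trace_form /mxtrace.
have M_ii (i : 'I_(\dim {:g})) c : lie C e`_i = c *: e`_i ->
    (ad_mx e C *m ad_mx e C) i i = c ^+ 2.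
  move=> iC; have Mi j : ad_mx e C i j = c * (i == j)%:R.
    by rewrite mxE iC linearZ /= coord_free ?(basis_free e_basis).
  rewrite mxE (bigD1 i) //= big1 ?addr0 => [|j /negPf ji].
    by rewrite !Mi eqxx mulr1.
  by rewrite Mi eq_sym ji mulr0 mul0r.
have M_ge0 i : 0 <= (ad_mx e C *m ad_mx e C) i i.
  by have [c cr /M_ii ->] := eC i; rewrite -realEsqr.
move=> trM; have C0 (i : 'I_(\dim {:g})) : lie C e`_i = 0.
  have : (ad_mx e C *m ad_mx e C) i i = 0.
    exact: (psumr_eq0P (fun j _ => M_ge0 j) trM).
  by have [c _ iC] := eC i; rewrite (M_ii _ _ iC) iC => /eqP;
    rewrite sqrf_eq0 => /eqP->; rewrite scale0r.
have /eqP : lie C x = 0.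
  rewrite (coord_basis e_basis (memvf x)) linear_sum big1 // => i _.
  by rewrite linearZ /= C0 scaler0.
by have [_ ->] := ax; rewrite // scaler_eq0 (negPf aC) (negPf x0).
Qed.

End RootOpposite.

(** * The Cartan matrix of e_6 and its diagram symmetry *)

Section CartanMatrix.

Definition cartan_e6_adjugate : 'M[int]_6 :=
  \matrix_(i, j) nth 0 (nth [::]
    [:: [:: 6; 3;  6;  9;  6; 3];
        [:: 3; 4;  5;  6;  4; 2];
        [:: 6; 5; 10; 12;  8; 4];
        [:: 9; 6; 12; 18; 12; 6];
        [:: 6; 4;  8; 12; 10; 5];
        [:: 3; 2;  4;  6;  5; 4]] i) j.

Lemma cartan_e6_adjugateP : cartan_e6_adjugate *m cartan_e6 = 3%:M.
Proof.
apply/matrixP => i j; rewrite !mxE; under eq_bigr do rewrite !mxE.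
rewrite !big_ord_recl big_ord0 /=.
case: i j => [[|[|[|[|[|[|//]]]]]] ?] [[|[|[|[|[|[|//]]]]]] ?]; exact/eqP.
Qed.

(** The labels 0, ..., 5 are taken in Z/6, where the nontrivial symmetry of the
    diagram is i |-> - i: it fixes 0 and 3 (that is, alpha_1 and alpha_4) and
    exchanges 1 with 5 and 2 with 4 (alpha_2 with alpha_6, alpha_3 with
    alpha_5). *)
Lemma cartan_e6_adjugateN (i j : 'I_6) :
  cartan_e6_adjugate (- i) (- j) = cartan_e6_adjugate i j.
Proof.
rewrite !mxE.
by case: i j => [[|[|[|[|[|[|//]]]]]] ?] [[|[|[|[|[|[|//]]]]]] ?].
Qed.

Lemma cartan_e6N (i j : 'I_6) : cartan_e6 (- i) (- j) = cartan_e6 i j.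
Proof.
rewrite !mxE.
by case: i j => [[|[|[|[|[|[|//]]]]]] ?] [[|[|[|[|[|[|//]]]]]] ?].
Qed.

(** The inverse of the Cartan matrix commutes with the diagram symmetry, so the
    solution c inherits the symmetry of the right-hand side t. *)
Lemma cartan_e6_solve (F : numFieldType) (t : 'I_6 -> F) :
  exists c : 'I_6 -> F,
    (forall k, \sum_i c i * (cartan_e6 i k)%:~R = t k) /\
    ((forall i, t (- i) = t i) -> forall i, c (- i) = c i).
Proof.
exists (fun i => 3^-1 * \sum_j t j * (cartan_e6_adjugate j i)%:~R).
split=> [k|tN i]; last first.
  congr (_ * _); rewrite (reindex_inj oppr_inj) /=.
  by apply: eq_bigr => j _; rewrite tN cartan_e6_adjugateN.
under eq_bigr do rewrite -mulrA mulr_suml.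
rewrite -mulr_sumr exchange_big /=.
transitivity (3^-1 * \sum_j t j * (3%:M j k : int)%:~R).
  congr (_ * _); apply: eq_bigr => j _.
  rewrite -cartan_e6_adjugateP mxE rmorph_sum mulr_sumr.
  by apply: eq_bigr => i _; rewrite rmorphM mulrA.
rewrite (bigD1 k) //= big1 ?addr0 => [|j /negPf jk]; rewrite !mxE ?jk ?mulr0 //.
by rewrite eqxx mulrCA mulVf ?mulr1 // pnatr_eq0.
Qed.

(** The elements 0 and 3 of Z/6 are their own opposites and put no constraint
    on Pi; the two other orbits give the two conditions. *)
Lemma diagram_stableP (Pi : {set 'I_6}) :
  (forall i, i \in Pi -> - i \in Pi) <->
  ([set lab 2; lab 6] \subset Pi \/ [disjoint [set lab 2; lab 6] & Pi]) /\
  ([set lab 3; lab 5] \subset Pi \/ [disjoint [set lab 3; lab 5] & Pi]).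
Proof.
have l6 : lab 6 = - lab 2 by apply/val_inj; rewrite /= !inordK.
have l5 : lab 5 = - lab 3 by apply/val_inj; rewrite /= !inordK.
have pairP i : [set i; - i] \subset Pi \/ [disjoint [set i; - i] & Pi] <->
    (i \in Pi) = (- i \in Pi).
  rewrite subUset !sub1set disjoints_subset subUset !sub1set !in_setC.
  by case: (i \in Pi); case: (- i \in Pi); intuition.
rewrite l6 l5 !pairP; split=> [PiN|[P2 P3]].
  by split; apply/idP/idP => /PiN; rewrite ?opprK.
have fix_or i : [\/ - i = i, i = lab 2, i = - lab 2 | i = lab 3 \/ i = - lab 3].
  have vE : [/\ val (lab 2) = 1, val (- lab 2) = 5,
      val (lab 3) = 2 & val (- lab 3) = 4]%N.
    by rewrite /= !inordK.
  case: vE => v2 v6 v3 v5.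
  case: i => [[|[|[|[|[|[|//]]]]]] ?].
  - by constructor 1; apply/val_inj.
  - by constructor 2; apply/val_inj; rewrite v2.
  - by constructor 4; left; apply/val_inj; rewrite v3.
  - by constructor 1; apply/val_inj.
  - by constructor 4; right; apply/val_inj; rewrite v5.
  - by constructor 3; apply/val_inj; rewrite v6.
by move=> i; case: (fix_or i) => [->||| [|]] // ->; rewrite ?opprK ?P2 ?P3.
Qed.

End CartanMatrix.

(** * The subspace h_sp8 *)

Section Coweights.
Local Open Scope classical_set_scope.
Variables (F : numFieldType) (g : lieAlgType F) (h : {vspace g}).
Variables (alpha : 'I_6 -> dual h) (coroot : 'I_6 -> g).
Hypothesis coroot_h : forall i, coroot i \in h.
Hypothesis alpha_cartan :
  forall i j, ev (alpha j) (coroot i) = (cartan_e6 i j)%:~R.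

Lemma labN : [/\ - lab 1 = lab 1, - lab 2 = lab 6, - lab 3 = lab 5 &
  [/\ - lab 4 = lab 4, - lab 5 = lab 3 & - lab 6 = lab 2]].
Proof. by split; [| | |split]; apply/val_inj; rewrite /= !inordK. Qed.

Lemma sum_lab (V : zmodType) (f : 'I_6 -> V) :
  \sum_i f i = f (lab 1) + f (lab 2) + f (lab 3)
             + f (lab 4) + f (lab 5) + f (lab 6).
Proof.
rewrite !big_ord_recl big_ord0 addr0 !addrA.
by do ![congr (_ + _)]; congr f; apply/val_inj; rewrite /= inordK.
Qed.

Lemma h_sp8_sub_cartan : (h_sp8 coroot <= h)%VS.
Proof.
apply/span_subvP => _ /mapP[[j j4] _ ->]; move: j j4.
by case=> [|[|[|[|//]]]] ?; rewrite /beta_coroot /=;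
  do ?[exact: coroot_h | apply: rpredD | apply: rpredMn].
Qed.

Lemma ev_h_sp8N H i : H \in h_sp8 coroot -> ev (alpha (- i)) H = ev (alpha i) H.
Proof.
have [l1 l2 l3 [l4 l5 l6]] := labN.
have evN_coroot k : ev (alpha (- i)) (coroot k) = ev (alpha i) (coroot (- k)).
  by rewrite !alpha_cartan -[in RHS](opprK i) cartan_e6N.
pose U := [set x | ev (alpha (- i)) x = ev (alpha i) x].
have clU : lin_closed U.
  split=> [|c x y /= xE yE]; first by rewrite /U /= /ev !linear0.
  by rewrite /U /= !ev_linear xE yE.
move=> /(@coord_span _ _ _ (in_tuple _))->; rewrite -/(U _).
apply: (lin_closed_sum clU) => k _; apply: (lin_closedZ _ clU).
have /mapP[[j j4] _ ->] := mem_nth 0 (ltn_ord k).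
case: j j4 => [|[|[|[|//]]]] ?; rewrite /U /beta_coroot /= /ev.
all: rewrite ?linearD /= ?linearMn /= -!/(ev _ _) !evN_coroot.
all: by rewrite ?l1 ?l2 ?l3 ?l4 ?l5 ?l6; ring.
Qed.

(** The simple roots take arbitrary values on h.  For values t invariant under
    the diagram symmetry, so are the coefficients on the co-roots, and the
    invariant combinations of co-roots are those spanned by the co-roots of
    the beta_j. *)
Lemma coweight (t : 'I_6 -> F) : exists2 H, H \in h &
  (forall k, ev (alpha k) H = t k) /\
  ((forall i, t (- i) = t i) -> H \in h_sp8 coroot).
Proof.
have [c [cA cN]] := cartan_e6_solve t.
exists (\sum_i c i *: coroot i).
  by apply: rpred_sum => i _; rewrite rpredZ ?coroot_h.
split=> [k|/cN {}cN].
  rewrite /ev !linear_sum /= -[RHS]cA; apply: eq_bigr => i _.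
  by rewrite !linearZ -alpha_cartan.
have [l1 l2 l3 _] := labN.
have bh j (j4 : (j < 4)%N) : beta_coroot coroot (Ordinal j4) \in h_sp8 coroot.
  by apply/memv_span/map_f; rewrite mem_enum.
have b2 := bh 1 isT; have b3 := bh 2 isT; have b4 := bh 3 isT.
(* H_(alpha_1) is recovered from H_(beta_1), H_(beta_3) and H_(beta_4). *)
have b1 : coroot (lab 1) \in h_sp8 coroot.
  have := bh 0 isT; rewrite /beta_coroot /= (ACl (1*(2*4)*3)) /=.
  rewrite rpredDr ?rpredMn // rpredDr // -scaler_nat => /(rpredZ 2^-1).
  by rewrite scalerK // pnatr_eq0.
rewrite sum_lab -l2 -l3 !cN l2 l3 (ACl (1*(2*6)*(3*5)*4)) /= -!scalerDr.
by rewrite !rpredD ?rpredZ.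
Qed.

End Coweights.

(** * Positive roots and parabolic subalgebras *)

Section PositiveRoots.
Local Open Scope classical_set_scope.
Variables (F : numFieldType) (g : lieAlgType F) (h : {vspace g}) (n : nat).
Variables (delta : 'I_n -> dual h).

Lemma ev_nat_comb_ge0 (Pi : {set 'I_n}) (a : dual h) H :
    (forall k, k \in Pi -> 0 <= ev (delta k) H) -> nat_comb Pi delta a ->
  0 <= ev a H.
Proof.
move=> dH [c ->]; rewrite ev_sum sumr_ge0 // => i iPi.
by rewrite mulr_ge0 ?ler0n ?dH.
Qed.

(** On a rho where all simple roots are 1, a combination of simple roots takes
    its height as value. *)
Lemma nat_comb_height (a : dual h) rho : (forall k, ev (delta k) rho = 1) ->
    nat_comb [set: 'I_n]%SET delta a ->
  exists m : nat, [/\ ev a rho = m%:R, m = 0%N -> a = 0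
    & m = 1%N -> exists k, a = delta k].
Proof.
move=> drho [c aE]; exists (\sum_(i in [set: 'I_n]%SET) c i)%N; split.
- by rewrite aE ev_sum natr_sum; apply: eq_bigr => i _; rewrite drho mulr1.
- move/eqP; rewrite sum_nat_eq0 => /forall_inP c0.
  by rewrite aE big1 // => i iT; rewrite (eqP (c0 i iT)).
- move/eqP/sum_nat_eq1 => [k [kT ck c0]]; exists k.
  rewrite aE (bigD1 k) //= ck big1 ?addr0 // => i /andP[iT ik].
  by rewrite c0.
Qed.

Lemma height_real_neq0 (a : dual h) rho : is_simple_system fullv delta ->
    (forall k, ev (delta k) rho = 1) -> is_root fullv a ->
  ev a rho \is Num.real /\ ev a rho != 0.
Proof.
move=> [_ _ pos] drho ra; have [a0 _] := ra.
have [/(nat_comb_height drho)|/(nat_comb_height drho)] := pos a ra.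
  move=> [m [-> m0 _]]; rewrite realn; split=> //; rewrite pnatr_eq0.
  by apply: contraNneq a0 => /m0->.
move=> [m [aE m0 _]]; rewrite -realN -oppr_eq0 -evN aE realn; split=> //.
by rewrite pnatr_eq0; apply: contraNneq a0 => /m0 /eqP; rewrite oppr_eq0.
Qed.

End PositiveRoots.

Section Parabolics.
Local Open Scope classical_set_scope.
Variables (R : realType) (g : lieAlgType R[i]) (h : {vspace g}).
Hypothesis g_simple : is_simple_lie g.
Hypothesis h_cartan : is_cartan fullv h.

Lemma parabolic_ofE (H : g) :
  parabolic_of H = lin_span (eigen_union (ad H) [set a | 0 <= a]).
Proof.
congr lin_span; apply/seteqP; split=> x [a a0].
  by rewrite /= mem_leigenspace => /eqP; exists a.
by exists a => //=; rewrite mem_leigenspace; apply/eqP.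
Qed.

Lemma parabolic_of_automorphism (tau : 'End(g)) (H x : g) :
    (forall x y, tau (lie x y) = lie (tau x) (tau y)) -> tau H = H ->
  parabolic_of H x -> parabolic_of H (tau x).
Proof.
move=> tau_lie tauH; rewrite !parabolic_ofE.
have [U0 UD] := lin_span_closed (eigen_union (ad H) [set a | 0 <= a]).
move: x; apply: lin_span_min => [|x [a a0 xE]].
  split=> [|c x y /= xU yU] /=; first by rewrite linear0.
  by rewrite linearP; apply: UD.
apply: lin_span_gen; exists a => //; rewrite adE in xE.
by rewrite adE -{1}tauH -tau_lie xE linearZ.
Qed.

Lemma hyperbolic_of_real (H : g) : H \in h ->
    (forall a : dual h, is_root fullv a -> ev a H \is Num.real) ->
  is_hyperbolic H.
Proof.
have [_ hab _ ss] := h_cartan.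
move=> Hh Hreal; split=> [|c]; first exact: ss.
apply: contraPT => creal; apply/negP; rewrite negbK -subv0; apply/subvP => x.
rewrite mem_leigenspace => /eqP xE; rewrite memv0; apply/eqP.
apply: (@lin_span_eigen_disjoint _ _ (ad H) [set c] [set a | a \is Num.real]).
- by move=> _ ->; apply/negP.
- by apply: lin_span_gen; exists c.
have := root_decomposition x h_cartan; move: {xE} x.
apply: lin_span_min => [|y [hy|[b br [_ yb]]]]; first exact: lin_span_closed.
  by apply: lin_span_gen; exists 0; rewrite ?adE /= ?real0 // scale0r hab.
by apply: lin_span_gen; exists (ev b H); rewrite ?adE ?yb //; apply: Hreal.
Qed.

Variables (n : nat) (delta : 'I_n -> dual h) (rho : g).
Hypothesis delta_simple : is_simple_system fullv delta.
Hypothesis rho_h : rho \in h.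
Hypothesis delta_rho : forall k, ev (delta k) rho = 1.

(** The generators of p_Pi are eigenvectors of ad H with eigenvalue >= 0.
    Conversely, root vectors outside p_Pi have a negative eigenvalue: if - a
    is a combination of simple roots and a(H) = 0, then only simple roots with
    index in Pi occur.  So g is the sum of p_Pi and of the part of negative
    eigenvalues, and p(H) meets the latter in 0. *)
Lemma parabolic_of_dominant (Pi : {set 'I_n}) (H : g) : H \in h ->
    (forall k, 0 <= ev (delta k) H) ->
    (forall k, (ev (delta k) H == 0) = (k \in Pi)) ->
  parabolic_of H = std_parabolic delta Pi.
Proof.
move=> Hh H_ge0 H_eq0; have [_ hab _ _] := h_cartan.
rewrite parabolic_ofE.
have std_sub : std_parabolic delta Pi
    `<=` lin_span (eigen_union (ad H) [set a | 0 <= a]).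
  apply: lin_span_min; first exact: lin_span_closed.
  move=> x xgen; apply: lin_span_gen; move: xgen.
  case=> [[hx|[a [ra na] [_ xa]]]|[a [ra na] [_ xa]]].
  - by exists 0 => //=; rewrite adE scale0r hab.
  - by exists (ev a H); [apply: ev_nat_comb_ge0 na | rewrite adE xa].
  - exists (ev (- a) H); last by rewrite adE xa.
    have [c ->] := na; rewrite /= evN ev_sum big1 ?oppr0 // => k.
    by rewrite -H_eq0 => /eqP->; rewrite mulr0.
apply/seteqP; split=> // x xH.
have : lin_span
    (std_parabolic delta Pi `|` eigen_union (ad H) [set a | a < 0]) x.
  have := root_decomposition x h_cartan; move: {xH} x.
  apply: lin_span_min => [|x [hx|[a ra xa]]]; first exact: lin_span_closed.
    by apply: lin_span_gen; left; apply: lin_span_gen; left; left.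
  apply: lin_span_gen; have [_ _ pos] := delta_simple.
  have [na|na] := pos a ra.
    by left; apply: lin_span_gen; left; right; exists a.
  have [rreal rneq0] := height_real_neq0 delta_simple delta_rho ra.
  have ra' : is_root fullv (- a).
    apply: is_root_opp rneq0 ra => // b rb.
    by have [] := height_real_neq0 delta_simple delta_rho rb.
  have aH_le0 : ev a H <= 0.
    by rewrite -oppr_ge0 -evN; apply: ev_nat_comb_ge0 na => k _.
  have [aH0|aH_neq0] := eqVneq (ev a H) 0; last first.
    right; exists (ev a H); first by rewrite /= lt_neqAle aH_neq0.
    by have [_ ax] := xa; rewrite adE ax.
  left; apply: lin_span_gen; right; exists (- a); last by rewrite opprK.
  split; first by split.
  have [c aE] := na; exists c; rewrite aE.
  rewrite [LHS](bigID (mem Pi)) /= [X in _ + X]big1 ?addr0.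
    by apply: eq_bigl => k; rewrite inE.
  move=> k /andP[_ kPi].
  have /eqP : ev (- a) H = 0 by rewrite evN aH0 oppr0.
  rewrite aE ev_sum psumr_eq0 => [/allP/(_ k (mem_index_enum _))|i _];
    last first.
    by rewrite mulr_ge0 ?ler0n.
  by rewrite inE /= mulf_eq0 H_eq0 (negPf kPi) orbF pnatr_eq0 => /eqP->.
move=> /lin_spanU[y [z [yP zN xE]]].
have {}yP : std_parabolic delta Pi y.
  move: yP; apply: lin_span_min => //; exact: lin_span_closed.
suff z0 : z = 0 by rewrite xE z0 addr0.
apply: (@lin_span_eigen_disjoint _ _ (ad H)
  [set a | a < 0] [set a | 0 <= a]) => //.
  by move=> a /= a_lt0 /(lt_le_trans a_lt0); rewrite ltxx.
have -> : z = x - y by rewrite xE addrAC subrr add0r.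
by apply: lin_closedB => //; [apply: lin_span_closed | apply: std_sub].
Qed.

(** The element H is the fundamental coweight of index k.  If k were not in Pi,
    ad H would have eigenvalues >= 0 on p_Pi, and - 1 on x. *)
Lemma mem_of_opp_root_in_std_parabolic (Pi : {set 'I_n}) k x H : H \in h ->
    (forall j, ev (delta j) H = (j == k)%:R) ->
    x != 0 -> root_space fullv (- delta k) x -> std_parabolic delta Pi x ->
  k \in Pi.
Proof.
move=> Hh dH x0 [_ xk] xP; apply: contraT => kPi; case/eqP: x0.
have [_ hab _ _] := h_cartan.
apply: (@lin_span_eigen_disjoint _ _ (ad H) [set a | a < 0] [set a | 0 <= a]).
- by move=> a /= a_lt0 /(lt_le_trans a_lt0); rewrite ltxx.
- apply: lin_span_gen; exists (-1); first by rewrite /= oppr_lt0.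
  by rewrite adE xk // evN dH eqxx.
move: {xk} x xP; apply: lin_span_min; first exact: lin_span_closed.
move=> x xgen; apply: lin_span_gen; move: xgen.
case=> [[hx|[a [ra na] [_ xa]]]|[a [ra na] [_ xa]]].
- by exists 0 => //=; rewrite adE scale0r hab.
- exists (ev a H); last by rewrite adE xa.
  by apply: ev_nat_comb_ge0 na => j _; rewrite dH.
- exists (ev (- a) H); last by rewrite adE xa.
  have [c ->] := na; rewrite /= evN ev_sum big1 ?oppr0 // => j jPi.
  by rewrite dH; case: eqP jPi kPi => [-> ->|_ _ _] //; rewrite mulr0.
Qed.

End Parabolics.

(** Since no root vanishes on rho, the centraliser of rho is the zero weight
    space h. *)
Lemma regular_centralizer (F : numFieldType) (g : lieAlgType F) (h : {vspace g})
    (n : nat) (delta : 'I_n -> dual h) (rho x : g) :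
    is_cartan fullv h -> is_simple_system fullv delta -> rho \in h ->
    (forall k, ev (delta k) rho = 1) -> lie rho x = 0 -> x \in h.
Proof.
move=> hC dS rho_h drho rx; have [_ hab _ _] := hC.
have [u [v [uh vr xE]]] := lin_spanU (root_decomposition x hC).
have {}uh : u \in h by apply: (lin_span_min (lin_closed_vspace h)) uh.
suff v0 : v = 0 by rewrite xE v0 addr0.
apply: (@lin_span_eigen_disjoint _ _ (ad rho) [set a | a != 0] [set 0]).
- by move=> a /= /[swap] ->; rewrite eqxx.
- move: {xE} v vr; apply: lin_span_min; first exact: lin_span_closed.
  move=> v [a ra [_ va]]; apply: lin_span_gen; exists (ev a rho).
    by have [] := height_real_neq0 dS drho ra.
  by rewrite adE va.
- apply: lin_span_gen; exists 0 => //; rewrite scale0r.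
  have -> : v = x - u by rewrite xE addrAC subrr add0r.
  by rewrite adE linearB /= rx hab // subrr.
Qed.

(** * The action of tau on h *)

Section Involution.
Variables (F : numFieldType) (g : lieAlgType F) (h : {vspace g}).
Variables (alpha : 'I_6 -> dual h) (coroot : 'I_6 -> g) (tau : 'End(g)).
Hypothesis h_cartan : is_cartan fullv h.
Hypothesis alpha_simple : is_simple_system fullv alpha.
Hypothesis coroot_h : forall i, coroot i \in h.
Hypothesis alpha_cartan :
  forall i j, ev (alpha j) (coroot i) = (cartan_e6 i j)%:~R.
Hypothesis tau_inv : is_involutive_automorphism tau.
Hypothesis h_sp8_cartan : is_cartan (fixedSpace tau) (h_sp8 coroot).

Let tau_lie x y : tau (lie x y) = lie (tau x) (tau y).
Proof. by case: tau_inv. Qed.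

Let tauK x : tau (tau x) = x.
Proof. by case: tau_inv => _ /lfunP/(_ x); rewrite comp_lfunE id_lfunE. Qed.

Lemma tau_h_sp8 y : y \in h_sp8 coroot -> tau y = y.
Proof. by case: h_sp8_cartan => /subvP sub _ _ _ /sub /fixedSpaceP. Qed.

Lemma regular_in_h_sp8 : exists2 rho, rho \in h_sp8 coroot &
  forall k, ev (alpha k) rho = 1.
Proof.
have [rho _ [rhoE rho_sp8]] := coweight coroot_h alpha_cartan (fun=> 1).
by exists rho => //; apply: rho_sp8.
Qed.

Lemma tau_cartan y : y \in h -> tau y \in h.
Proof.
move=> hy; have [rho rho_sp8 alpha_rho] := regular_in_h_sp8.
have rho_h := subvP (h_sp8_sub_cartan coroot_h) _ rho_sp8.
apply: (regular_centralizer h_cartan alpha_simple rho_h alpha_rho).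
rewrite -(tau_h_sp8 rho_sp8) -tau_lie.
by case: h_cartan => _ hab _ _; rewrite hab ?linear0.
Qed.

(** The fixed points of tau in h form an abelian subalgebra of g^tau that
    contains the Cartan subalgebra h_sp8. *)
Lemma fixed_in_h_sp8 y : y \in h -> tau y = y -> y \in h_sp8 coroot.
Proof.
case: h_sp8_cartan => sub _ hmax _ hy /fixedSpaceP fy.
rewrite -(hmax (h :&: fixedSpace tau)%VS) ?memv_cap ?hy //.
- by rewrite subv_cap sub h_sp8_sub_cartan.
- exact: capvSr.
- case: h_cartan => _ hab _ _ u v; rewrite !memv_cap => /andP[hu _] /andP[hv _].
  exact: hab.
Qed.

Lemma root_space_tau (a b : dual h) x : root_space fullv a x ->
  (forall y, y \in h -> ev b y = ev a (tau y)) -> root_space fullv b (tau x).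
Proof.
move=> [_ ax] ba; split=> [|y hy]; first exact: memvf.
by rewrite -{1}[y]tauK -tau_lie ax ?tau_cartan // linearZ ba.
Qed.

(** Evaluating at rho shows that a has height 1, so that it is a simple root;
    evaluating at the coweight with value 1 on alpha_i and alpha_(- i) and 0 on
    the other simple roots identifies it. *)
Lemma root_eq_simple_on_h_sp8 (a : dual h) i : is_root fullv a ->
    (forall y, y \in h_sp8 coroot -> ev a y = ev (alpha i) y) ->
  a = alpha i \/ a = alpha (- i).
Proof.
move=> ra ai; have [rho rho_sp8 alpha_rho] := regular_in_h_sp8.
have arho : ev a rho = 1 by rewrite ai.
have [_ _ pos] := alpha_simple.
have [k ak] : exists k, a = alpha k.
  have [/(nat_comb_height alpha_rho)|/(nat_comb_height alpha_rho)] := pos a ra.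
    move=> [m [aE _]]; apply; apply/eqP.
    by rewrite -(eqr_nat F) -aE arho.
  move=> [m [/eqP]]; rewrite evN arho eq_sym -subr_eq0 opprK.
  by rewrite natr1 pnatr_eq0.
have [H _ [alphaH H_sp8]] := coweight coroot_h alpha_cartan
  (fun j => ((j == i) || (j == - i))%:R).
have {}H_sp8 : H \in h_sp8 coroot.
  by apply: H_sp8 => j; rewrite !eqr_oppLR opprK orbC.
have := ai H H_sp8; rewrite ak !alphaH eqxx /=.
case: eqP => [->|_] /=; first by left.
by case: eqP => [->|_ /eqP]; [right | rewrite eq_sym oner_eq0].
Qed.

(** Both alpha_i o tau and alpha_(- i) o tau are one of alpha_i, alpha_(- i).
    If alpha_i o tau = alpha_i, evaluating at y + tau y, which is in h_sp8,
    gives alpha_i = alpha_(- i) whichever of the two alpha_(- i) o tau is, so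
    the formula holds in this case too. *)
Lemma ev_alpha_tau i y : y \in h -> ev (alpha i) (tau y) = ev (alpha (- i)) y.
Proof.
have key j : (forall z, z \in h -> ev (alpha j) (tau z) = ev (alpha j) z) \/
    (forall z, z \in h -> ev (alpha j) (tau z) = ev (alpha (- j)) z).
  have [|a aE] := @dualP _ _ h (fun z => ev (alpha j) (tau z)).
    by move=> c u v; rewrite linearP ev_linear.
  have [_ roots _] := alpha_simple; have [_ [x xj x0]] := roots j.
  have [rho rho_sp8 alpha_rho] := regular_in_h_sp8.
  have rho_h := subvP (h_sp8_sub_cartan coroot_h) _ rho_sp8.
  have ra : is_root fullv a.
    split; last first.
      exists (tau x); first exact: root_space_tau xj _.
      by apply: contraNneq x0 => tx0; rewrite -[x]tauK tx0 linear0.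
    apply/eqP => a0; have := aE rho rho_h.
    by rewrite a0 ev0 tau_h_sp8 // alpha_rho => /eqP; rewrite eq_sym oner_eq0.
  have [z z_sp8|aj|aj] := root_eq_simple_on_h_sp8 (i := j) ra.
  - have z_h := subvP (h_sp8_sub_cartan coroot_h) _ z_sp8.
    by rewrite aE // tau_h_sp8.
  - by left=> z hz; rewrite -aE // aj.
  - by right=> z hz; rewrite -aE // aj.
have [i_fixed hy|] := key i; last exact.
have : ev (alpha (- i)) (y + tau y) = ev (alpha i) (y + tau y).
  apply: (ev_h_sp8N alpha_cartan); apply: fixed_in_h_sp8.
    by rewrite rpredD ?tau_cartan.
  by rewrite linearD /= tauK addrC.
rewrite -[y]scale1r !ev_linear !scale1r !mul1r i_fixed //.
have [->|->] := key (- i) => //; last first.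
  by rewrite opprK => /addIr.
by rewrite -!mulr2n => /pmulrnI->.
Qed.

End Involution.

(** * Compatible standard parabolic subalgebras *)

Theorem proposition11 (R : realType) (g : lieAlgType R[i]) (h : {vspace g})
    (alpha : 'I_6 -> dual h) (coroot : 'I_6 -> g) (tau : 'End(g))
    (* g is of type e_6, with Cartan subalgebra h and simple system alpha *)
    (g_simple : is_simple_lie g)
    (h_cartan : is_cartan fullv h)
    (alpha_simple : is_simple_system fullv alpha)
    (alpha_coroot : forall i, is_coroot fullv (alpha i) (coroot i))
    (alpha_cartan : forall i j, ev (alpha j) (coroot i) = (cartan_e6 i j)%:~R)
    (* sp(8,C) as the fixed-point algebra of tau *)
    (tau_inv : is_involutive_automorphism tau)
    (tau_sp8 : is_isomorphic_to_sp8 (fixedSpace tau))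
    (h_sp8_cartan : is_cartan (fixedSpace tau) (h_sp8 coroot))
    (beta_simple : is_simple_system (fixedSpace tau)
       (fun j => restr_dual (h_sp8 coroot) (beta alpha j)))
    (beta_coroots : forall j, is_coroot (fixedSpace tau)
       (restr_dual (h_sp8 coroot) (beta alpha j)) (beta_coroot coroot j)) :
  forall Pi : {set 'I_6},
    is_compatible (fixedSpace tau) (std_parabolic alpha Pi) <->
    ([set lab 2; lab 6] \subset Pi \/ [disjoint [set lab 2; lab 6] & Pi]) /\
    ([set lab 3; lab 5] \subset Pi \/ [disjoint [set lab 3; lab 5] & Pi]).
Proof.
move=> Pi; rewrite -diagram_stableP.
have coroot_h i : coroot i \in h by case: (alpha_coroot i).
have h_sp8_h := subvP (h_sp8_sub_cartan coroot_h).
have [rho rho_sp8 alpha_rho] := regular_in_h_sp8 coroot_h alpha_cartan.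
have rho_h := h_sp8_h _ rho_sp8.
split=> [[H [H_fix _ PiE]] i iPi|PiN].
  (* p_Pi is tau-stable; follow a root vector x for - alpha_i through tau. *)
  have [_ roots _] := alpha_simple.
  have ri : is_root fullv (- alpha i).
    apply: (is_root_opp g_simple h_cartan rho_h _ _ (roots i)).
      by move=> b rb; have [] := height_real_neq0 alpha_simple alpha_rho rb.
    by rewrite alpha_rho oner_eq0.
  have [_ [x xi x0]] := ri.
  have [H' H'_h [alphaH' _]] := coweight coroot_h alpha_cartan
    (fun j => (j == - i)%:R).
  apply: (mem_of_opp_root_in_std_parabolic h_cartan H'_h alphaH' (x := tau x)).
  - apply: contraNneq x0 => tx0.
    have [_ /lfunP/(_ x) + _] := tau_inv.
    rewrite comp_lfunE id_lfunE tx0 linear0.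
    by move=> <-.
  - apply: (root_space_tau h_cartan alpha_simple coroot_h alpha_cartan tau_inv
      h_sp8_cartan xi) => y hy.
    by rewrite !evN (ev_alpha_tau h_cartan alpha_simple coroot_h alpha_cartan
      tau_inv h_sp8_cartan).
  - rewrite PiE; apply: parabolic_of_automorphism.
    + by case: tau_inv.
    + exact/fixedSpaceP.
    rewrite -PiE; apply: lin_span_gen; right; exists (alpha i) => //.
    have ai (S : {set 'I_6}) : i \in S -> nat_comb S alpha (alpha i).
      move=> iS; exists (fun j => (j == i) : nat).
      by rewrite (bigD1 i) //= eqxx big1 ?addr0 // => j /andP[_ /negPf->].
    by split; [split; [exact: roots | exact/ai/in_setT] | exact: ai].
(* H defines p_Pi, and the stability of Pi puts it in h_sp8. *)
have [H H_h [alphaH H_sp8]] := coweight coroot_h alpha_cartan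
  (fun k => (k \notin Pi)%:R).
have {}H_sp8 : H \in h_sp8 coroot.
  apply: H_sp8 => k; congr (~~ _)%:R; apply/idP/idP => /PiN //.
  by rewrite opprK.
have alphaH_ge0 k : 0 <= ev (alpha k) H by rewrite alphaH ler0n.
exists H; split.
- by have [/subvP sub _ _ _] := h_sp8_cartan; apply: sub.
- apply: (hyperbolic_of_real h_cartan H_h) => a ra.
  have [_ _ pos] := alpha_simple.
  have [na|na] := pos a ra.
    by apply/ger0_real; apply: ev_nat_comb_ge0 na.
  by rewrite -realN -evN; apply/ger0_real; apply: ev_nat_comb_ge0 na.
- symmetry; apply: (parabolic_of_dominant g_simple h_cartan alpha_simple
    rho_h alpha_rho H_h) => // k.
  by rewrite alphaH pnatr_eq0 eqb0 negbK.
Qed.
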